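(* There exists a constant $C<\infty$ such that for all integers $n\ge 1$ and $d\ge 3$ (with $C$ independent of $n,d$) and for any $f:[2^n]^d\to\mathbb{R}$, $$\sum_{k=8}^n \mathbb{E}\left|\int f\,\mathrm{d}\nu_k\right|\le C\|f\|_{W^{1,1}}.$$
   Context: $[2^n]^d=\{1,\dots,2^n\}^d$ is the grid graph with edge set $E([2^n]^d)$ consisting of pairs $\{u,v\}$ with $u-v=\pm e_i$ for some standard basis vector $e_i$ of $\mathbb{R}^d$. For $f:[2^n]^d\to\mathbb{R}$, the $(1,1)$-Sobolev (semi)norm is $$\|f\|_{W^{1,1}}=\frac{1}{|E([2^n]^d)|}\sum_{\{u,v\}\in E([2^n]^d)}2^n|f(v)-f(u)|.$$ For $A\subseteq[2^n]^d$, $\mathrm{Vol}(A)=2^{-nd}|A|$ (normalized counting measure). For $k\in\{1,\dots,n\}$, $\mathcal{D}_k$ is the collection of the $2^{kd}$ dyadic cubes $Q=\prod_{i=1}^d I^{(k)}_{j_i}$, $(j_i)_{i=1}^d\in\{1,\dots,2^k\}^d$, where $I^{(k)}_j=\{1+(j-1)2^{n-k},\dots,j2^{n-k}\}$. For $Q\in\mathcal{D}_k$, $\mathrm{Vol}_Q(A)=\mathrm{Vol}(A\cap Q)$. Set $p=2^{-4d}$, and let $\{X_Q\}_{Q\in\mathcal{D}_k}$ be i.i.d. random variables with $\mathbb{P}(X_Q=1)=\mathbb{P}(X_Q=-1)=p/2$ and $\mathbb{P}(X_Q=0)=1-p$. Define the random signed measures on $[2^n]^d$ $$\mu_k=\sum_{Q\in\mathcal{D}_k}p^{-1}2^kX_Q\mathrm{Vol}_Q,\qquad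 \nu_k=\mu_k-\mu_k([2^n]^d)\,\mathrm{Vol}.$$ A sum over an empty range of $k$ is $0$. *)

(* Defs.v *)
From HB Require Import structures.
From mathcomp Require Import all_boot all_order all_algebra.
From mathcomp Require Import all_classical all_reals all_analysis.
Set Implicit Arguments.
Unset Strict Implicit.
Unset Printing Implicit Defensive.
Import Order.TTheory GRing.Theory Num.Theory.
Local Open Scope ring_scope.

(* Coordinates are 0-based: x : grid n d stands for the point (x i + 1)_i of
   {1, ..., 2^n}^d. *)
Definition grid (n d : nat) : finType := {ffun 'I_d -> 'I_(2 ^ n)}.

(* u - v = e_i or u - v = - e_i for some i. *)
Definition grid_adj (n d : nat) (u v : grid n d) : bool :=
  [exists i, [exists s : bool, [forall j,
     (u j)%:Z - (v j)%:Z == (-1) ^+ s * (j == i)%:Z]]].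

Definition edges (n d : nat) : {set {set grid n d}} :=
  [set [set p.1; p.2] | p : grid n d * grid n d & grid_adj p.1 p.2]%SET.

(* |f v - f u| as a function of the unordered pair e = {u, v};
   see edge_diffE. *)
Definition edge_diff (R : realType) (n d : nat) (f : grid n d -> R)
    (e : {set grid n d}) : R :=
  \big[Num.max/0]_(u in e) \big[Num.max/0]_(v in e) `|f v - f u|.

Lemma edge_diffE (R : realType) (n d : nat) (f : grid n d -> R)
    (u v : grid n d) : edge_diff f [set u; v]%SET = `|f v - f u|.
Proof.
rewrite /edge_diff; apply/eqP; rewrite eq_le; apply/andP; split.
  apply: bigmax_le => // a /set2P[] ->; apply: bigmax_le => // b /set2P[] ->;
    by rewrite ?subrr ?normr0 // distrC.
apply: (@bigmax_sup _ _ _ _ u) => //; first by rewrite set21.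
by apply: (@bigmax_sup _ _ _ _ v) => //; rewrite set22.
Qed.

Definition sobolev11 (R : realType) (n d : nat) (f : grid n d -> R) : R :=
  #|edges n d|%:R^-1 * \sum_(e in edges n d) 2 ^+ n * edge_diff f e.

Definition Vol (R : realType) (n d : nat) (A : {set grid n d}) : R :=
  2 ^- (n * d) * #|A|%:R.

(* The dyadic cube of generation k with (0-based) multi-index j.  For k <= n,
   j |-> dyadic_cube n j is injective, so that the 2^(k d) cubes of D_k are
   indexed by grid k d. *)
Definition dyadic_cube (n d k : nat) (j : grid k d) : {set grid n d} :=
  [set x : grid n d |
    [forall i, (j i * 2 ^ (n - k) <= x i < (j i).+1 * 2 ^ (n - k))%N]]%SET.

Definition Vol_cube (R : realType) (n d k : nat) (j : grid k d)
    (A : {set grid n d}) : R :=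
  Vol R (A :&: dyadic_cube n j)%SET.

Definition sparsity (R : realType) (d : nat) : R := 2 ^- (4 * d).

(* mu_k and nu_k as set functions, for a realization x of (X_Q)_{Q in D_k}. *)
Definition mu (R : realType) (n d k : nat) (x : grid k d -> R)
    (A : {set grid n d}) : R :=
  \sum_(j : grid k d) (sparsity R d)^-1 * 2 ^+ k * x j * Vol_cube R j A.

Definition nu (R : realType) (n d k : nat) (x : grid k d -> R)
    (A : {set grid n d}) : R :=
  mu x A - mu x [set: grid n d]%SET * Vol R A.

(* Integral of f against a finitely additive signed measure m on all subsets
   of the finite set grid n d. *)
Definition integral_grid (R : realType) (n d : nat) (f : grid n d -> R)
    (m : {set grid n d} -> R) : R :=
  \sum_(x : grid n d) f x * m [set x]%SET.

Definition mutually_independent (dd : measure_display) (T : measurableType dd)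
    (R : realType) (P : probability T R) (I : finType)
    (X : I -> {RV P >-> R}) : Prop :=
  forall (J : {set I}) (B : I -> set R),
    (forall i, i \in J -> measurable (B i)) ->
    P (\bigcap_(i in [set` J]) (X i @^-1` B i))%classic
    = (\prod_(i in J) P (X i @^-1` B i)%classic)%E.

Definition sparse_sign_law (dd : measure_display) (T : measurableType dd)
    (R : realType) (P : probability T R) (p : R) (X : {RV P >-> R}) : Prop :=
  [/\ P (X @^-1` [set 1])%classic = (p / 2)%:E,
      P (X @^-1` [set -1])%classic = (p / 2)%:E
    & P (X @^-1` [set 0])%classic = (1 - p)%:E].

Definition iid_sparse_signs (dd : measure_display) (T : measurableType dd)
    (R : realType) (P : probability T R) (p : R) (I : finType)
    (X : I -> {RV P >-> R}) : Prop :=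
  mutually_independent X /\ forall i, sparse_sign_law p (X i).

(* Main.v *)
Require Import Defs.
From HB Require Import structures.
From mathcomp Require Import all_boot all_order all_algebra.
From mathcomp Require Import all_classical all_reals all_analysis.
From mathcomp Require Import measurable_realfun ring lra zify.
Set Implicit Arguments.
Unset Strict Implicit.
Unset Printing Implicit Defensive.
Import Order.TTheory GRing.Theory Num.Theory.
Local Open Scope ring_scope.

(** Why the inequality holds.

    Both sides behave well under the layer-cake decomposition of [f]: the left
    side is subadditive, positively homogeneous and vanishes on constants, while
    the total variation is additive along the layers ([total_variation_layer]).
    So it is enough to treat the indicator of a set [A] ([layer_cake_ind]), and
    since complementing [A] changes neither side, a set of density
    [a = Vol A <= 1/2].

    The integral of [f] against [nu_k] is a sum [\sum_Q c_Q X_Q], where [c_Q] is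
    proportional to the integral of [f - mean f] over the cube [Q]
    ([integral_nuE]).  Its first absolute moment has two bounds.  The triangle
    inequality gives [p \sum_Q |c_Q|], which for an indicator is at most
    [2^(k+1) a].  The second moment gives [(p \sum_Q c_Q^2)^(1/2)], which is at
    most [2^(2d + k - kd/2) a^(1/2)]: for [d >= 3] this decays geometrically in
    [k], the cost of the sparsity being the factor [p^(-1/2) = 2^(2d)].

    Let [m] be the scale of [A], i.e. [2^(-(m+1)d) < a <= 2^(-md)].  The first
    bound is used for [k <= m + 12].  From [k = m + 13] on, the decay of the
    second bound has absorbed the factor [2^(2d)], uniformly in [d >= 3].
    Hence, when [m >= 1], the sum over [k] is of order [a 2^m]; when [m = 0]
    only the second bound is needed, and starting at [k = 8] makes the
    sum smaller than [a/d] up to a constant.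

    These are exactly the orders of magnitude of the Sobolev norm of the
    indicator.  A Loomis-Whitney type inequality ([cylinder_isoperimetry])
    bounds from below the number of lines that meet [A]; a line that meets [A]
    and is not contained in it carries a boundary edge ([card_cylinder_le]).
    This gives [Vol A * (2^n - L) <= L * sobolev11 (indicator of A)] whenever
    [|A| <= L^d] ([sobolev11_isoperimetry]).  The side [L = 2^(n-m)] yields the
    bound of order [a 2^m], and [L = 2^n (1 - 1/(2d))] the bound of order
    [a/d]. *)

(** * Lines and cylinders in a discrete cube *)

Definition set_coord (I : finType) (N : nat) (i : I) (t : 'I_N)
    (x : {ffun I -> 'I_N}) : {ffun I -> 'I_N} :=
  [ffun j => if j == i then t else x j].

Lemma set_coord_eq (I : finType) (N : nat) (i : I) (t : 'I_N)
  (x : {ffun I -> 'I_N}) : set_coord i t x i = t.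
Proof. by rewrite ffunE eqxx. Qed.

Lemma set_coord_neq (I : finType) (N : nat) (i j : I) (t : 'I_N)
  (x : {ffun I -> 'I_N}) : j != i -> set_coord i t x j = x j.
Proof. by move=> /negbTE ji; rewrite ffunE ji. Qed.

Lemma set_coord_twice (I : finType) (N : nat) (i : I) (s t : 'I_N)
  (x : {ffun I -> 'I_N}) : set_coord i s (set_coord i t x) = set_coord i s x.
Proof. by apply/ffunP => j; rewrite !ffunE; case: eqP. Qed.

Lemma set_coord_id (I : finType) (N : nat) (i : I)
  (x : {ffun I -> 'I_N}) : set_coord i (x i) x = x.
Proof. by apply/ffunP => j; rewrite !ffunE; case: eqP => // ->. Qed.

(** The map that swaps [t] with the [i]-th coordinate of [x] is an involution
    on pairs [(x, t)]; it turns the left side into a sum over [x] alone.  This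
    replaces sums over lines by sums over all points, each line being counted
    [N] times. *)
Lemma sum_set_coord (V : nmodType) (I : finType) (N : nat) (i : I)
  (h : {ffun I -> 'I_N} -> V) :
  \sum_x \sum_t h (set_coord i t x) = (\sum_x h x) *+ N.
Proof.
pose s (p : {ffun I -> 'I_N} * 'I_N) := (set_coord i p.2 p.1, p.1 i).
have sK : involutive s.
  by case=> x t; rewrite /s /= set_coord_eq set_coord_twice set_coord_id.
rewrite pair_big (reindex_inj (inv_inj sK)) /=.
rewrite -(pair_big predT predT
  (fun (x : {ffun I -> 'I_N}) (t : 'I_N) =>
     h (set_coord i (x i) (set_coord i t x)))) /=.
rewrite -sumrMnl; apply: eq_bigr => x _.
under eq_bigr do rewrite set_coord_twice set_coord_id.
by rewrite sumr_const card_ord.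
Qed.

Lemma card_sum_indic (R : pzSemiRingType) (T : finType) (A : {set T}) :
  #|A|%:R = \sum_x (x \in A)%:R :> R.
Proof. by rewrite -sum1_card natr_sum big_mkcond; apply: eq_bigr=> x _; case: (x \in A). Qed.

(** The union of the lines in direction [i] that meet [A].  Its cardinality is
    [N] times that of the projection of [A] along [i]; working with it avoids a
    change of ambient space. *)
Definition cylinder (I : finType) (N : nat) (i : I)
    (A : {set {ffun I -> 'I_N}}) : {set {ffun I -> 'I_N}} :=
  [set x | [exists t, set_coord i t x \in A]]%SET.

Definition slice (I : finType) (N : nat) (i : I) (t : 'I_N)
    (A : {set {ffun I -> 'I_N}}) : {set {ffun I -> 'I_N}} :=
  [set x in A | x i == t]%SET.

Lemma card_slices (I : finType) (N : nat) (i : I)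
  (A : {set {ffun I -> 'I_N}}) : (\sum_t #|slice i t A|)%N = #|A|.
Proof.
rewrite -[RHS]sum1_card (partition_big (fun x : {ffun I -> 'I_N} => x i) predT) //=.
by apply: eq_bigr => t _; rewrite -sum1_card; apply: eq_bigl => x; rewrite inE.
Qed.

Lemma slice_cylinder (I : finType) (N : nat) (i j : I) (t : 'I_N)
  (A : {set {ffun I -> 'I_N}}) : j != i ->
  slice j t (cylinder i A) = cylinder i (slice j t A).
Proof.
move=> ji; apply/setP => x; rewrite !inE; apply/andP/existsP => [[/existsP[s xA] xt]|[s]].
  by exists s; rewrite inE xA set_coord_neq.
by rewrite inE set_coord_neq// => /andP[xA ->]; split => //; apply/existsP; exists s.
Qed.

(** The points of one slice lie on distinct lines in direction [i]. *)
Lemma card_slice_le_cylinder (R : realType) (I : finType) (N : nat) (i : I)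
  (t : 'I_N) (A : {set {ffun I -> 'I_N}}) :
  N%:R * #|slice i t A|%:R <= #|cylinder i A|%:R :> R.
Proof.
rewrite mulr_natl !card_sum_indic.
rewrite -(sum_set_coord i (fun x => (x \in slice i t A)%:R : R)).
apply: ler_sum => x _; rewrite (bigD1 t)//= big1 ?addr0; last first.
  by move=> s /negbTE st; rewrite inE set_coord_eq st andbF.
rewrite !inE set_coord_eq eqxx andbT ler_nat.
by case xA : (set_coord i t x \in A) => //=; rewrite lt0b; apply/existsP; exists t.
Qed.

Lemma weighted_AMGM (R : realType) (r : nat) (L m : R) : 0 <= L -> 0 <= m ->
  r.+1%:R * (L ^+ r * m) <= r%:R * L ^+ r.+1 + m ^+ r.+1.
Proof.
move=> L0 m0; elim: r => [|r IH]; first by rewrite !mul1r mul0r add0r expr1.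
have h : 0 <= r.+1%:R * L ^+ r * (m - L) ^+ 2.
  by rewrite mulr_ge0 ?sqr_ge0// mulr_ge0// exprn_ge0.
have := ler_wpM2l m0 IH; rewrite !exprS -!natr1 in h *; nra.
Qed.

(** The right side minus the left side is affine in [V], so it suffices to look
    at the endpoints [V = 0] and [V = L^(r+1)]; the latter is
    [weighted_AMGM]. *)
Lemma weighted_AMGM_le (R : realType) (r : nat) (L m V : R) : 0 < L -> 0 <= m ->
  0 <= V -> V <= L ^+ r.+1 -> r.+1%:R * (V * m) <= L * (r%:R * V + m ^+ r.+1).
Proof.
move=> L0 m0 V0 VL; have [h|/ltW h] := leP (r.+1%:R * m) (r%:R * L).
  have := ler_wpM2r V0 h; have : 0 <= L * m ^+ r.+1 by rewrite mulr_ge0 ?exprn_ge0// ltW.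
  nra.
have : V * (r.+1%:R * m - r%:R * L) <= L ^+ r.+1 * (r.+1%:R * m - r%:R * L).
  by rewrite ler_wpM2r// subr_ge0.
have := ler_wpM2l (ltW L0) (weighted_AMGM r (ltW L0) m0).
rewrite !exprS; nra.
Qed.

(** A Loomis-Whitney type inequality: for a set with at most [L^|J|] points, the
    ratio of its total projection along the directions of [J] to its volume is
    at least that of a cube of side [L].  By induction on [J]: choose [i] in [J] and cut [A] into slices along
    [i].  The projections of [A] along the other directions are the disjoint
    unions of those of the slices, to which the induction hypothesis applies
    with a side [m] such that the largest slice has [m^s] points; the projection
    along [i] has at least as many points as that slice.  The weighted AM-GM
    inequality combines the two contributions. *)
Lemma cylinder_isoperimetry (R : realType) (I : finType) (N : nat)
  (J : {set I}) (A : {set {ffun I -> 'I_N}}) (L : R) : 0 < L ->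
  #|A|%:R <= L ^+ #|J| ->
  #|J|%:R * #|A|%:R * N%:R <= L * \sum_(i in J) #|cylinder i A|%:R.
Proof.
have [r rJ] := ubnP #|J|; elim: r => // r IH in J A L rJ * => L0 AL.
have [->|/finset.set0Pn[i iJ]] := eqVneq J finset.set0.
  by rewrite cards0 !mul0r big_set0 mulr0.
have cJ : #|J| = (#|J :\ i|).+1%SET by rewrite (cardsD1 i) iJ.
set s := #|(J :\ i)%SET| in cJ; rewrite cJ in AL *.
have [->|/finset.set0Pn[a aA]] := eqVneq A finset.set0.
  by rewrite cards0 mulr0 mul0r mulr_ge0 ?(ltW L0)// sumr_ge0.
pose t := [arg max_(t > a i) #|slice i t A|].
have tM u : (#|slice i u A| <= #|slice i t A|)%N.
  by rewrite /t; case: arg_maxnP => // v _; apply.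
have M1 : (0 < #|slice i t A|)%N.
  apply: leq_trans (tM (a i)); rewrite card_gt0; apply/finset.set0Pn; exists a.
  by rewrite inE aA eqxx.
rewrite (big_setD1 i)//=; set C := #|cylinder i A|%:R.
have hC : N%:R * #|slice i t A|%:R <= C := card_slice_le_cylinder R i t A.
(* No root of order 0: for a single direction one nonempty slice suffices. *)
have [s0|s0] := posnP s.
  move: AL; rewrite s0 expr1 mul1r => AL.
  rewrite (cards0_eq s0) big_set0 addr0.
  apply: ler_pM => //; apply: le_trans hC.
  by rewrite ler_peMr// ler1n.
(* [m] is the side of an s-dimensional cube with as many points as the largest
   slice, so that the induction hypothesis applies to all slices with side m. *)
pose M : R := #|slice i t A|%:R; pose m := M `^ s%:R^-1.
have M0 : 0 < M by rewrite ltr0n.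
have m0 : 0 < m by apply: powR_gt0.
have mM : m ^+ s = M.
  rewrite -powR_mulrn ?ltW// -powRrM mulVf ?powRr1 ?ltW//.
  by rewrite pnatr_eq0 -lt0n.
have hC' : s%:R * #|A|%:R * N%:R <= m * \sum_(j in (J :\ i)%SET) #|cylinder j A|%:R.
  rewrite -(card_slices i A) natr_sum mulr_sumr mulr_suml.
  under [X in _ <= _ * X]eq_bigr => j jJ.
    have ij : i != j by move: jJ; rewrite !inE eq_sym => /andP[].
    rewrite -(card_slices i (cylinder j A)) natr_sum.
    under eq_bigr do rewrite slice_cylinder//.
    over.
  rewrite exchange_big /= mulr_sumr; apply: ler_sum => u _.
  apply: IH => //; first by rewrite -/s -ltnS -cJ.
  by rewrite -/s mM ler_nat.
rewrite -(ler_pM2l m0).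
have := weighted_AMGM_le L0 (ltW m0) (ler0n R #|A|) AL.
have N0 : 0 <= N%:R :> R by [].
move/(ler_wpM2l N0).
have : N%:R * (m ^+ s.+1) <= m * C.
  by rewrite exprS mM mulrCA ler_wpM2l// ltW.
move/(ler_wpM2l (ltW L0)).
have := ler_wpM2l (ltW L0) hC'.
lra.
Qed.

(** The value at the last point is that point itself, so that difference
    quotients along a line vanish there and need no side condition. *)
Definition next (N : nat) (t : 'I_N) : 'I_N := insubd t t.+1.

Lemma val_next (N : nat) (t : 'I_N) : (t.+1 < N)%N -> next t = t.+1 :> nat.
Proof. by move=> tN; rewrite val_insubd tN. Qed.

Lemma next_last (N : nat) (t : 'I_N) : (N <= t.+1)%N -> next t = t.
Proof. by rewrite leqNgt => /negbTE tN; apply: val_inj; rewrite val_insubd tN. Qed.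

Lemma ler_line_variation (R : realType) (N : nat) (g : 'I_N -> R) (s t : 'I_N) :
  `|g s - g t| <= \sum_u `|g (next u) - g u|.
Proof.
wlog st : s t / (s <= t)%N.
  move=> wl; case/orP: (leq_total s t) => ?; first exact: wl.
  by rewrite distrC; exact: wl.
apply: (@le_trans _ _ (\sum_(u : 'I_N | (s <= u < t)%N) `|g (next u) - g u|)).
  have [k kt] := ubnP t; elim: k t st kt => // k IH t st kt.
  have [<-|sneqt] := eqVneq s t.
    by rewrite subrr normr0 sumr_ge0.
  have slt : (s < t)%N by rewrite ltn_neqAle sneqt.
  have t0 : (0 < t)%N by apply: leq_ltn_trans slt.
  have t'N : (t.-1 < N)%N by rewrite prednK// ltnW.
  pose t' := Ordinal t'N.
  have nt' : next t' = t by apply: ord_inj; rewrite val_next /= prednK.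
  rewrite (bigD1 t')/=; last by rewrite -ltnS prednK// slt leqnn.
  rewrite nt' [leRHS]addrC (le_trans (ler_distD (g t') _ _))//.
  rewrite (distrC (g t')) lerD2r.
  apply: le_trans (IH t' _ _) _.
  - by rewrite -ltnS prednK.
  - by rewrite prednK.
  rewrite big_mkcond [leRHS]big_mkcond; apply: ler_sum => u _.
  case: ifPn => [/andP[su ut]|_]; last by case: ifP.
  rewrite su (ltn_trans ut) ?prednK//=; case: eqP => // ut'.
  by move: ut; rewrite ut' /= ltnn.
by rewrite big_mkcond; apply: ler_sum => u _; case: ifP.
Qed.

(** * Total variation, and the Sobolev norm as a normalized total variation *)

Definition variation (R : realType) (I : finType) (N : nat) (i : I)
    (f : {ffun I -> 'I_N} -> R) : R :=
  \sum_(x : {ffun I -> 'I_N}) `|f (set_coord i (next (x i)) x) - f x|.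

Definition total_variation (R : realType) (I : finType) (N : nat)
    (f : {ffun I -> 'I_N} -> R) : R :=
  \sum_i variation i f.

Definition indic_set (R : realType) (T : finType) (A : {set T}) (x : T) : R :=
  (x \in A)%:R.
Arguments indic_set R [T] A x.

(** A line that meets [A] either carries a boundary edge or lies in [A]. *)
Lemma card_cylinder_le (R : realType) (I : finType) (N : nat) (i : I)
  (A : {set {ffun I -> 'I_N}}) :
  #|cylinder i A|%:R <= N%:R * variation i (indic_set R A) + #|A|%:R.
Proof.
have [N0|N0] := posnP N.
  rewrite (_ : cylinder i A = finset.set0) ?cards0.
    by rewrite addr_ge0// mulr_ge0// sumr_ge0.
  apply/setP => x; rewrite !inE; apply/negbTE/existsP => -[t _].
  by case: t => t; rewrite N0.
have N0' : 0 < N%:R :> R by rewrite ltr0n.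
rewrite -(ler_pM2l N0') card_sum_indic mulr_sumr.
pose D (y : {ffun I -> 'I_N}) := `|indic_set R A (set_coord i (next (y i)) y) - indic_set R A y|.
apply: (@le_trans _ _ (\sum_x (N%:R * (\sum_t D (set_coord i t x))
    + \sum_t indic_set R A (set_coord i t x)))); last first.
  rewrite big_split/= -mulr_sumr !sum_set_coord.
  by rewrite mulrnAr -mulrnDl [leRHS]mulr_natl card_sum_indic.
apply: ler_sum => x _; rewrite inE.
(* A point of A and a point outside A on a common line force variation >= 1
   there; averaging over t compares with the share of the line inside A. *)
have line s t : `|indic_set R A (set_coord i s x) - indic_set R A (set_coord i t x)|
    <= \sum_u D (set_coord i u x).
  apply: le_trans (ler_line_variation (fun u => indic_set R A (set_coord i u x)) s t) _.
  by apply: ler_sum => u _; rewrite /D set_coord_eq set_coord_twice.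
case: existsP => [[s sA]|_]; last first.
  rewrite mulr0; apply: addr_ge0; [apply: mulr_ge0 => //|];
    by apply: sumr_ge0 => t _; rewrite /D /indic_set.
have sumN (c : R) : N%:R * c = \sum_(t < N) c.
  by rewrite sumr_const card_ord mulr_natl.
rewrite !sumN -big_split/=.
apply: ler_sum => t _; rewrite -lerBlDr; apply: le_trans (line s t).
by rewrite {2}/indic_set sA ler_norm.
Qed.

Lemma total_variation_isoperimetry (R : realType) (I : finType) (N : nat)
  (A : {set {ffun I -> 'I_N}}) (L : R) : 0 < L -> #|A|%:R <= L ^+ #|I| ->
  #|I|%:R * #|A|%:R * (N%:R - L) <=
    L * (N%:R * total_variation (indic_set R A)).
Proof.
move=> L0 AL; have := @cylinder_isoperimetry R I N [set: I]%SET A L L0.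
rewrite cardsT => /(_ AL) iso; rewrite mulrBr lerBlDr (le_trans iso)//.
rewrite [_ * L]mulrC -mulrDr ler_wpM2l ?(ltW L0)//.
rewrite mulr_sumr mulr_natl -sumr_const -big_split/=.
under eq_bigl do rewrite inE.
by apply: ler_sum => i _; exact: card_cylinder_le.
Qed.

Definition edge_of (n d : nat) (p : grid n d * 'I_d) : {set grid n d} :=
  [set p.1; set_coord p.2 (next (p.1 p.2)) p.1]%SET.

(** Each edge is coded by its lower endpoint and its direction. *)
Definition edge_code (n d : nat) : {set grid n d * 'I_d} :=
  [set p : grid n d * 'I_d | (p.1 p.2).+1 < 2 ^ n]%N%SET.

Lemma edges_image (n d : nat) : edges n d = (@edge_of n d @: edge_code n d)%SET.
Proof.
apply/setP => e; apply/imsetP/imsetP => [[[u v]]|[[x i]]].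
  rewrite inE /= => /existsP[i /existsP[s /forallP uv]] ->.
  wlog s0 : u v s uv / s = true.
    move=> wl; case: s uv => uv; first exact: (wl u v true).
    have [||p pE vuE] := wl v u true => //.
      by move=> j; have := uv j; rewrite !expr0 !expr1 mul1r mulN1r -eqr_oppLR opprB.
    by exists p => //; rewrite finset.setUC.
  have E j : (v j : nat) = (u j + (j == i))%N.
    have := uv j; rewrite s0 expr1 mulN1r subr_eq addrC -subr_eq opprK => /eqP.
    by rewrite -PoszD => -[->].
  have vi := E i; rewrite eqxx addn1 in vi.
  have ui : ((u i).+1 < 2 ^ n)%N by rewrite -vi.
  exists (u, i); first by rewrite inE.
  rewrite /edge_of /=; congr [set _; _]%SET; apply/ffunP => j; rewrite ffunE.
  apply: ord_inj; case: eqP => [->|/eqP/negbTE ji]; first by rewrite val_next.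
  by rewrite E ji addn0.
rewrite inE /= => xi ->; exists (x, set_coord i (next (x i)) x); last by [].
rewrite inE /=; apply/existsP; exists i; apply/existsP; exists true.
apply/forallP => j; rewrite ffunE expr1 mulN1r.
have [->|_] := eqVneq j i; last by rewrite subrr oppr0.
by rewrite val_next// intS opprD addrC subrK.
Qed.

Lemma edge_of_inj (n d : nat) : {in edge_code n d &, injective (@edge_of n d)}.
Proof.
move=> [x i] [y j]; rewrite !inE /= => xi yj; rewrite /edge_of /= => E.
(* The sum of the coordinates orients each edge. *)
pose w (z : grid n d) := (\sum_k z k)%N.
have up (z : grid n d) k : ((z k).+1 < 2 ^ n)%N -> w (set_coord k (next (z k)) z) = (w z).+1.
  move=> zk; rewrite /w (bigD1 k)//= [in RHS](bigD1 k)//= set_coord_eq val_next//.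
  by rewrite addSn; congr (_ + _).+1; apply: eq_bigr => l lk; rewrite set_coord_neq.
have xy : x = y.
  have : x \in [set y; set_coord j (next (y j)) y]%SET by rewrite -E set21.
  case/set2P => // xE.
  have : y \in [set x; set_coord i (next (x i)) x]%SET by rewrite E set21.
  case/set2P => // yE.
  have := up _ _ xi; rewrite -yE => w1; have := up _ _ yj; rewrite -xE => w2.
  have wxy : (w x < w y)%N by rewrite w1.
  have wyx : (w y < w x)%N by rewrite w2.
  by have := ltn_trans wxy wyx; rewrite ltnn.
congr (_, _); first by [].
subst y.
have : set_coord i (next (x i)) x \in [set x; set_coord j (next (x j)) x]%SET.
  by rewrite -E set22.
case/set2P => [/(congr1 w)|/(congr1 (fun z : grid n d => nat_of_ord (z i)))].
  by rewrite up// => /eqP; rewrite eqn_leq ltnn.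
rewrite set_coord_eq val_next//; have [//|ij] := eqVneq i j.
by rewrite set_coord_neq// => /eqP; rewrite eqn_leq ltnn.
Qed.

Lemma card_edges_le (n d : nat) : (#|edges n d| <= d * 2 ^ (n * d))%N.
Proof.
rewrite edges_image (leq_trans (leq_imset_card _ _))//.
rewrite (leq_trans (max_card _))// card_prod card_ffun !card_ord.
by rewrite mulnC expnM.
Qed.

Lemma card_edges_gt0 (n d : nat) : (0 < n)%N -> (0 < d)%N -> (0 < #|edges n d|)%N.
Proof.
move=> n0 d0; rewrite edges_image card_in_imset; last exact: edge_of_inj.
have N1 : (1 < 2 ^ n)%N by rewrite -{1}(expn0 2) ltn_exp2l.
rewrite card_gt0; apply/finset.set0Pn.
by exists ([ffun=> Ordinal (ltnW N1)], Ordinal d0); rewrite inE /= ffunE.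
Qed.

Lemma sum_edge_diff (R : realType) (n d : nat) (f : grid n d -> R) :
  \sum_(e in edges n d) edge_diff f e = total_variation f.
Proof.
rewrite edges_image big_imset/=; last exact: edge_of_inj.
rewrite /total_variation exchange_big pair_big/= big_mkcond/=.
apply: eq_bigr => -[x i] _ /=; rewrite inE /=; case: ltnP => xi.
  exact: edge_diffE.
by rewrite next_last// set_coord_id subrr normr0.
Qed.

Lemma sobolev11E (R : realType) (n d : nat) (f : grid n d -> R) :
  sobolev11 f = #|edges n d|%:R^-1 * (2 ^+ n * total_variation f).
Proof. by rewrite /sobolev11 -mulr_sumr sum_edge_diff. Qed.

Lemma total_variation_ge0 (R : realType) (I : finType) (N : nat)
  (f : {ffun I -> 'I_N} -> R) : 0 <= total_variation f.
Proof. by apply: sumr_ge0 => i _; apply: sumr_ge0. Qed.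

Lemma total_variation_le_sobolev11 (R : realType) (n d : nat)
  (f : grid n d -> R) : (0 < n)%N -> (0 < d)%N ->
  2 ^+ n * total_variation f <= d%:R * 2 ^+ (n * d) * sobolev11 f.
Proof.
move=> n0 d0; rewrite sobolev11E mulrA ler_peMl//.
  by rewrite mulr_ge0 ?exprn_ge0 ?total_variation_ge0.
rewrite ler_pdivlMr ?ltr0n ?card_edges_gt0// mul1r -natrX -natrM ler_nat.
exact: card_edges_le.
Qed.

(** * First moments of sparse signed sums *)

Lemma sum_pair (V : nmodType) (A B : finType) (F : A * B -> V) :
  \sum_s F s = \sum_a \sum_b F (a, b).
Proof. by rewrite pair_bigA; apply: eq_bigr => -[]. Qed.

(** Only the probabilities of the events [E s] enter the bound, which is what
    makes independence, a statement on finitely many events, directly usable. *)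
Lemma expectation_le_indic_sum (R : realType) (dd : measure_display)
  (T : measurableType dd) (P : probability T R) (S : finType) (b : S -> R)
  (E : S -> set T) (Y : T -> R) :
  measurable_fun setT Y -> (forall w, 0 <= Y w) ->
  (forall s, measurable (E s)) -> (forall w, 0 <= \sum_s b s * \1_(E s) w) ->
  {ae P, forall w, Y w <= \sum_s b s * \1_(E s) w} ->
  ('E_P[Y] <= (\sum_s b s * fine (P (E s)))%:E)%E.
Proof.
move=> mY Y0 mE b0 Yb.
apply: (@le_trans _ _ ('E_P[fun w => (\sum_s b s * \1_(E s) w)%R])%E).
  apply: expectation_le => //.
  apply: measurable_sum => s; apply: measurable_funM.
    exact: measurable_cst.
  exact: measurable_indic.
have iE s : P.-integrable setT (fun w => ((b s)%:E * (\1_(E s) w)%:E)%E).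
  exact/integrableZl/integrable_indic.
rewrite unlock.
under eq_integral do (rewrite -sumEFin; under eq_bigr do rewrite EFinM).
rewrite integral_sum// -sumEFin; apply: lee_sum => s _.
rewrite integralZl//; last exact: integrable_indic.
by rewrite integral_indic// setIT EFinM fineK// fin_num_measure.
Qed.

Section sparse_sign_sums.
Context (R : realType) (dd : measure_display) (T : measurableType dd).
Context (P : probability T R) (p : R) (I : finType) (X : I -> {RV P >-> R}).
Context (iidX : iid_sparse_signs p X).

Let sign_event (k : I * bool) : set T := (X k.1 @^-1` [set (-1) ^+ k.2])%classic.

Let measurable_sign_event k : measurable (sign_event k).
Proof. by rewrite -[sign_event k]setTI; exact: measurable_funP. Qed.

Let sign_sum i w : R := \sum_(e : bool) (-1) ^+ e * \1_(sign_event (i, e)) w.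

Let sign_eventP k w : (w \in sign_event k) = (X k.1 w == (-1) ^+ k.2).
Proof. by apply/idP/eqP => [|h]; rewrite inE. Qed.

Let prob_sign_event k : fine (P (sign_event k)) = p / 2.
Proof.
case: k => i e; have [_ /(_ i)[P1 PN1 _]] := iidX.
by case: e; rewrite /sign_event /= ?expr1 ?expr0 ?P1 ?PN1.
Qed.

(** The three values of the law have total probability 1. *)
Let sign_sumP : {ae P, forall w, forall i, X i w = sign_sum i w}.
Proof.
apply: filter_forall => i; have [_ /(_ i)[P1 PN1 P0]] := iidX.
pose pre (r : R) : set T := (X i @^-1` [set r])%classic.
have mpre r : measurable (pre r).
  by rewrite -[pre r]setTI; exact: measurable_funP.
have pre_disj r s : r != s -> (pre r `&` pre s = set0)%classic.
  move=> rs; apply/seteqP; split => // w [/= wr ws].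
  by move: rs; rewrite -wr -ws eqxx.
have n1 : (1 : R) != -1.
  by rewrite -subr_eq0 opprK (_ : 1 + 1 = 2%:R)// pnatr_eq0.
have n0 (e : R) : e = 1 \/ e = -1 -> e != 0.
  by case=> ->; rewrite ?oppr_eq0 oner_eq0.
pose A := (pre 1 `|` pre (-1) `|` pre 0)%classic.
have mA : measurable A by apply: measurableU => //; exact: measurableU.
have PA : P A = 1%E.
  rewrite measureU//; [rewrite measureU//|exact: measurableU|].
  - transitivity ((p / 2)%:E + (p / 2)%:E + (1 - p)%:E)%E.
      by congr (_ + _ + _)%E; [exact: P1|exact: PN1|exact: P0].
    by rewrite -!EFinD; congr _%:E; field.
  - exact: pre_disj.
  - by rewrite setIUl !pre_disj ?setU0// n0; auto.
exists (~` A)%classic; split.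
- exact: measurableC.
- by rewrite probability_setC ?PA ?subee.
- move=> w /= + Aw; apply.
  rewrite /sign_sum big_bool /= !indicE !sign_eventP/= expr1 expr0.
  case: Aw => [[]|] /= ->.
  + by rewrite eqxx (negbTE n1) /=; ring.
  + by rewrite eqxx eq_sym (negbTE n1) /=; ring.
  + by rewrite !(eq_sym 0) oppr_eq0 oner_eq0 /=; ring.
Qed.

(** Independence, for the pair of indices [k.1] and [l.1]. *)
Let prob_sign_events k l : k.1 != l.1 ->
  fine (P (sign_event k `&` sign_event l)%classic) = (p / 2) ^+ 2.
Proof.
move=> kl; have [indep _] := iidX.
pose B i : set R := if i == k.1 then [set (-1) ^+ k.2]%classic else [set (-1) ^+ l.2]%classic.
have mB i : measurable (B i) by rewrite /B; case: ifP.
have := indep [set k.1; l.1]%SET B (fun i _ => mB i).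
rewrite big_setU1 ?inE//= big_set1 /B eqxx (negbTE (_ : l.1 != k.1)) 1?eq_sym//.
rewrite -[in RHS]/(sign_event k) -[in RHS]/(sign_event l).
rewrite (_ : bigcap _ _ = sign_event k `&` sign_event l)%classic => [->|].
  by rewrite fineM ?fin_num_measure// !prob_sign_event expr2.
apply/seteqP; split => [w h|w [hk hl] i /=].
  split; first by have /= := h k.1; rewrite eqxx; apply; rewrite /= set21.
  have /= := h l.1; rewrite (negbTE (_ : l.1 != k.1)) 1?eq_sym//; apply.
  by rewrite /= set22.
by case/set2P => ->; rewrite ?eqxx// (negbTE (_ : l.1 != k.1)) 1?eq_sym.
Qed.

Let measurable_sum_sign (a : I -> R) :
  measurable_fun setT (fun w => `|\sum_i a i * X i w|).
Proof.
apply: measurableT_comp => //; apply: measurable_sum => i.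
exact: measurable_funM.
Qed.

(** The triangle inequality, with [E|X_i| = p]. *)
Lemma expectation_sparse_sum_le_l1 (a : I -> R) :
  ('E_P[fun w => `|\sum_i a i * X i w|%R] <= (p * \sum_i `|a i|)%:E)%E.
Proof.
pose b (k : I * bool) := `|a k.1|.
have -> : p * \sum_i `|a i| = \sum_k b k * fine (P (sign_event k)).
  under [RHS]eq_bigr do rewrite prob_sign_event.
  rewrite -(pair_big predT predT (fun i (e : bool) => b (i, e) * (p / 2)))/= mulr_sumr.
  by apply: eq_bigr => i _; rewrite big_bool /b/=; field.
have b0 k w : 0 <= b k * \1_(sign_event k) w by rewrite /b mulr_ge0.
apply: expectation_le_indic_sum => //; first by move=> w; exact: sumr_ge0.
apply: filterS sign_sumP => w Xw.
rewrite sum_pair.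
apply: (le_trans (ler_norm_sum _ _ _)); apply: ler_sum => i _.
rewrite Xw normrM /b /= -mulr_sumr ler_wpM2l//.
apply: (le_trans (ler_norm_sum _ _ _)); apply: ler_sum => e _.
by rewrite normrM normrX normrN1 expr1n mul1r ger0_norm.
Qed.

(** For [t > 0], [|S| <= t / 2 + S^2 / (2 t)] pointwise.  By independence and
    symmetry the cross terms of [E S^2] cancel, so that
    [E S^2 = p \sum_i a_i^2].  Stating the bound with a parameter [t] instead of
    a square root keeps the later estimates polynomial. *)
Lemma expectation_sparse_sum_le_l2 (a : I -> R) (t : R) : 0 < t ->
  p * \sum_i a i ^+ 2 <= t ^+ 2 ->
  ('E_P[fun w => `|\sum_i a i * X i w|%R] <= t%:E)%E.
Proof.
move=> t0 at2.
(* The majorant t / 2 + S^2 / (2 t) of |S|, expanded as a combination of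
   indicators: [inl tt] carries the constant, [inr (k, l)] the product terms. *)
pose K := (I * bool)%type.
pose b (s : unit + K * K) : R := if s is inr (k, l) then
  (2 * t)^-1 * (a k.1 * (-1) ^+ k.2 * (a l.1 * (-1) ^+ l.2)) else t / 2.
pose E (s : unit + K * K) : set T := if s is inr (k, l) then
  (sign_event k `&` sign_event l)%classic else setT.
have mE s : measurable (E s).
  by case: s => [[]|[k l]]//=; exact: measurableI.
pose S w := \sum_i a i * sign_sum i w.
have SE w : S w = \sum_(k : K) a k.1 * (-1) ^+ k.2 * \1_(sign_event k) w.
  rewrite sum_pair.
  by apply: eq_bigr => i _; rewrite /sign_sum mulr_sumr; apply: eq_bigr => e _; rewrite mulrA.
have bE w : \sum_s b s * \1_(E s) w = t / 2 + (2 * t)^-1 * S w ^+ 2.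
  rewrite big_sumType (big_pred1 tt); last by case.
  rewrite {1}/E indicT mulr1; congr (_ + _).
  rewrite expr2 [X in _ * (X * _)]SE mulr_suml mulr_sumr sum_pair.
  apply: eq_bigr => k _; rewrite SE mulr_sumr mulr_sumr; apply: eq_bigr => l _.
  by rewrite /b /E indicI /=; ring.
have bP : \sum_s b s * fine (P (E s)) <= t.
  rewrite big_sumType (big_pred1 tt); last by case.
  rewrite {1}/E probability_setT mulr1 /=.
  have -> : \sum_(s : K * K) b (inr s) * fine (P (E (inr s))) =
      (2 * t)^-1 * (p * \sum_i a i ^+ 2).
    rewrite sum_pair [LHS]sum_pair !mulr_sumr; apply: eq_bigr => i _.
    under eq_bigr => e _.
      rewrite sum_pair.
      rewrite (bigD1 i)//= [X in _ + X]big1 ?addr0; last first.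
        move=> j ji; rewrite big_bool /= !prob_sign_events ?(eq_sym i)//=.
        by rewrite expr1 expr0; ring.
      over.
    have PE e e' : fine (P (sign_event (i, e) `&` sign_event (i, e'))%classic)
        = if e == e' then p / 2 else 0.
      have [->|ee'] := eqVneq e e'; first by rewrite setIid prob_sign_event.
      rewrite (_ : _ `&` _ = set0)%classic ?measure0//.
      apply/seteqP; split => // w [] /=; rewrite /sign_event /= => -> /signr_inj eE.
      by move: ee'; rewrite eE eqxx.
    rewrite !big_bool /= !PE /= expr1 expr0; field.
    by rewrite (gt_eqF t0).
  have : (2 * t)^-1 * (p * \sum_i a i ^+ 2) <= (2 * t)^-1 * t ^+ 2.
    by rewrite ler_wpM2l// invr_ge0 mulr_ge0// ltW.
  have -> : (2 * t)^-1 * t ^+ 2 = t / 2 by field; rewrite (gt_eqF t0).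
  lra.
apply: (@le_trans _ _ (\sum_s b s * fine (P (E s)))%:E); last by rewrite lee_fin.
apply: expectation_le_indic_sum => //.
  move=> w; rewrite bE addr_ge0// ?divr_ge0// ?(ltW t0)// mulr_ge0 ?sqr_ge0//.
  by rewrite invr_ge0 mulr_ge0// ltW.
apply: filterS sign_sumP => w Xw; rewrite bE.
under eq_bigr do rewrite Xw.
rewrite -/(S w) -subr_ge0.
have -> : t / 2 + (2 * t)^-1 * S w ^+ 2 - `|S w| = (2 * t)^-1 * (t - `|S w|) ^+ 2.
  by rewrite -[S w ^+ 2]real_normK ?num_real//; field; rewrite (gt_eqF t0).
by rewrite mulr_ge0 ?sqr_ge0// invr_ge0 mulr_ge0// ltW.
Qed.

End sparse_sign_sums.

(** * The random measures in terms of cube averages *)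

Definition grid_mean (R : realType) (n d : nat) (g : grid n d -> R) : R :=
  2 ^- (n * d) * \sum_x g x.

Lemma grid_mean_ge0 (R : realType) (n d : nat) (g : grid n d -> R) :
  (forall x, 0 <= g x) -> 0 <= grid_mean g.
Proof. by move=> g0; rewrite mulr_ge0 ?invr_ge0 ?exprn_ge0// sumr_ge0. Qed.

Lemma grid_mean_indic (R : realType) (n d : nat) (A : {set grid n d}) :
  grid_mean (indic_set R A) = 2 ^- (n * d) * #|A|%:R.
Proof. by rewrite /grid_mean card_sum_indic. Qed.

Lemma grid_meanD (R : realType) (n d : nat) (g h : grid n d -> R) :
  grid_mean (fun x => g x + h x) = grid_mean g + grid_mean h.
Proof. by rewrite /grid_mean big_split mulrDr. Qed.

Lemma grid_mean_cst (R : realType) (n d : nat) (c : R) :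
  grid_mean (fun _ : grid n d => c) = c.
Proof.
rewrite /grid_mean sumr_const card_ffun !card_ord -expnM -[c *+ _]mulr_natl natrX.
by rewrite mulKf// gt_eqF// exprn_gt0.
Qed.

Lemma grid_mean_le (R : realType) (n d : nat) (g h : grid n d -> R) :
  (forall x, g x <= h x) -> grid_mean g <= grid_mean h.
Proof.
by move=> gh; rewrite /grid_mean ler_wpM2l ?invr_ge0 ?exprn_ge0// ler_sum.
Qed.

(** A point determines the cube of generation [k] that contains it; hence the
    cubes are disjoint. *)
Lemma dyadic_cube_div (n d k : nat) (j : grid k d) (x : grid n d) (i : 'I_d) :
  x \in dyadic_cube n j -> (x i %/ 2 ^ (n - k))%N = j i.
Proof.
rewrite inE => /forallP/(_ i)/andP[jx xj]; apply/eqP.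
by rewrite eqn_leq -ltnS ltn_divLR ?expn_gt0// xj leq_divRL ?expn_gt0.
Qed.

(** Reduction modulo the side of the cube is injective on the cube. *)
Lemma card_dyadic_cube_le (n d k : nat) (j : grid k d) :
  (#|dyadic_cube n j| <= 2 ^ ((n - k) * d))%N.
Proof.
have b0 : (0 < 2 ^ (n - k))%N by rewrite expn_gt0.
pose r (x : grid n d) : {ffun 'I_d -> 'I_(2 ^ (n - k))} :=
  [ffun i => Ordinal (ltn_pmod (x i) b0)].
have rI : {in dyadic_cube n j &, injective r}.
  move=> x y xj yj /ffunP rxy; apply/ffunP => i; apply: ord_inj.
  have := congr1 val (rxy i); rewrite !ffunE /= => xy.
  rewrite (divn_eq (x i) (2 ^ (n - k))) [RHS](divn_eq _ (2 ^ (n - k))) xy.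
  by rewrite !(dyadic_cube_div _ xj, dyadic_cube_div _ yj).
rewrite -(card_in_imset rI) (leq_trans (max_card _))//.
by rewrite card_ffun !card_ord expnM.
Qed.

Lemma sum_dyadic_cubes_le (R : realType) (n d k : nat) (g : grid n d -> R) :
  (forall x, 0 <= g x) ->
  \sum_(j : grid k d) \sum_(x in dyadic_cube n j) g x <= \sum_x g x.
Proof.
move=> g0; rewrite (exchange_big_dep predT)//=; apply: ler_sum => x _.
have [j xj|nj] := pickP (fun j : grid k d => x \in dyadic_cube n j).
  rewrite (big_pred1 j)// => l; apply/idP/eqP => [xl|-> //].
  apply/ffunP => i; apply: ord_inj.
  by rewrite -(dyadic_cube_div i xl) -(dyadic_cube_div i xj).
by rewrite big_pred0.
Qed.

(** Cauchy-Schwarz against the constant 1, from the positivity of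
    [\sum (|A| g_i - S)^2]. *)
Lemma sqr_sum_le (R : realType) (I : finType) (A : {set I}) (g : I -> R) :
  (\sum_(i in A) g i) ^+ 2 <= #|A|%:R * \sum_(i in A) g i ^+ 2.
Proof.
have [->|A0] := eqVneq A finset.set0; first by rewrite !big_set0 mulr0 expr2 mulr0.
have A0' : 0 < #|A|%:R :> R by rewrite ltr0n card_gt0.
set S := \sum_(i in A) g i.
have : 0 <= \sum_(i in A) (#|A|%:R * g i - S) ^+ 2 by apply: sumr_ge0 => i _; exact: sqr_ge0.
have -> : \sum_(i in A) (#|A|%:R * g i - S) ^+ 2 =
    #|A|%:R * (#|A|%:R * \sum_(i in A) g i ^+ 2 - S ^+ 2).
  under eq_bigr do rewrite sqrrB exprMn.
  rewrite big_split big_split /= -mulr_sumr sumr_const sumrN.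
  rewrite -(mulr_natl (S ^+ 2)).
  have -> : \sum_(i in A) #|A|%:R * g i * S *+ 2 = #|A|%:R * S * S *+ 2.
    by rewrite sumrMnl -mulr_suml -mulr_sumr.
  by rewrite mulr2n; ring.
by rewrite pmulr_rge0// subr_ge0.
Qed.

(** The coefficient of [X_Q] in the integral of [f] against [nu_k]; the
    subtraction of the total mass in [nu_k] becomes the centering of [f]. *)
Definition nu_coef (R : realType) (n d k : nat) (f : grid n d -> R)
    (j : grid k d) : R :=
  (sparsity R d)^-1 * 2 ^+ k *
    (2 ^- (n * d) * \sum_(x in dyadic_cube n j) (f x - grid_mean f)).

Lemma integral_nuE (R : realType) (n d k : nat) (f : grid n d -> R)
  (s : grid k d -> R) :
  integral_grid f (nu s) = \sum_j nu_coef f j * s j.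
Proof.
rewrite /integral_grid /nu; under eq_bigr do rewrite mulrBr.
have VolE (x : grid n d) : Vol R [set x]%SET = 2 ^- (n * d).
  by rewrite /Vol cards1 mulr1.
have fM (M : R) : \sum_x f x * (M * Vol R [set x]%SET) = M * grid_mean f.
  under eq_bigr do rewrite VolE mulrCA.
  by rewrite -mulr_sumr -mulr_suml [_ * 2 ^- _]mulrC.
rewrite sumrB fM /mu mulr_suml.
under eq_bigr do rewrite mulr_sumr.
rewrite exchange_big /= -sumrB; apply: eq_bigr => j _.
have cubeE (x : grid n d) : Vol_cube R j [set x]%SET =
    2 ^- (n * d) * (x \in dyadic_cube n j)%:R.
  rewrite /Vol_cube /Vol; congr (_ * _%:R).
  have [xC|xC] := boolP (x \in dyadic_cube n j).
    by rewrite (finset.setIidPl _) ?cards1// finset.sub1set.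
  rewrite (_ : _ :&: _ = finset.set0)%SET ?cards0//.
  apply/setP => y; rewrite finset.in_setI finset.in_set1 finset.in_set0.
  by apply: contraNF xC => /andP[/eqP <-].
have -> : \sum_x f x * ((sparsity R d)^-1 * 2 ^+ k * s j * Vol_cube R j [set x]%SET) =
    (sparsity R d)^-1 * 2 ^+ k * s j * 2 ^- (n * d) *
    \sum_(x in dyadic_cube n j) f x.
  rewrite [in RHS]big_mkcond mulr_sumr; apply: eq_bigr => x _.
  by rewrite cubeE; case: (x \in dyadic_cube n j) => /=; ring.
rewrite /nu_coef sumrB sumr_const /Vol_cube finset.setTI /Vol -mulr_natl; ring.
Qed.

(** The cubes are disjoint, so that the local means of the deviation add up to at
    most its global mean. *)
Lemma nu_coef_l1 (R : realType) (n d k : nat) (f : grid n d -> R) :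
  sparsity R d * (\sum_(j : grid k d) `|nu_coef f j|) <=
    2 ^+ k * grid_mean (fun x => `|f x - grid_mean f|).
Proof.
rewrite /grid_mean [leRHS]mulrA.
have c0 : 0 <= 2 ^+ k * 2 ^- (n * d) :> R by rewrite mulr_ge0 ?invr_ge0 ?exprn_ge0.
have key := sum_dyadic_cubes_le k (fun x => normr_ge0 (f x - grid_mean f)).
apply: le_trans (ler_wpM2l c0 key).
rewrite !mulr_sumr; apply: ler_sum => j _.
have -> : sparsity R d * `|nu_coef f j| = 2 ^+ k * 2 ^- (n * d) *
    `|\sum_(x in dyadic_cube n j) (f x - grid_mean f)|.
  rewrite /nu_coef /sparsity !normrM !normfV !normrX !normr_nat.
  by rewrite !mulrA mulfV ?gt_eqF ?invr_gt0 ?exprn_gt0// mul1r.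
by rewrite ler_wpM2l// ler_norm_sum.
Qed.

(** By Cauchy-Schwarz on each cube, which has at most [2^((n-k)d)] points. *)
Lemma nu_coef_l2 (R : realType) (n d k : nat) (f : grid n d -> R) : (k <= n)%N ->
  sparsity R d * (\sum_(j : grid k d) nu_coef f j ^+ 2) <=
    2 ^+ (4 * d) * 4 ^+ k * 2 ^- (k * d) *
    grid_mean (fun x => (f x - grid_mean f) ^+ 2).
Proof.
move=> kn.
set G := fun x => (f x - grid_mean f) ^+ 2.
have := sum_dyadic_cubes_le k (fun x => sqr_ge0 (f x - grid_mean f)).
have pow0 m : 0 < 2 ^+ m :> R by rewrite exprn_gt0.
set c := 2 ^+ (4 * d) * 4 ^+ k * 2 ^- (k * d) * 2 ^- (n * d) : R.
have c0 : 0 <= c by rewrite !mulr_ge0 ?invr_ge0 ?exprn_ge0.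
rewrite -[grid_mean G]/(2 ^- (n * d) * \sum_x G x) mulrA -/c.
move=> /(ler_wpM2l c0); apply: le_trans.
rewrite !mulr_sumr; apply: ler_sum => j _.
have h : (\sum_(x in dyadic_cube n j) (f x - grid_mean f)) ^+ 2 <=
    2 ^+ ((n - k) * d) * \sum_(x in dyadic_cube n j) G x.
  apply: (le_trans (sqr_sum_le _ _)); rewrite ler_wpM2r ?sumr_ge0//.
    by move=> x _; exact: sqr_ge0.
  by rewrite -natrX ler_nat card_dyadic_cube_le.
have e : 2 ^+ (n * d) = 2 ^+ ((n - k) * d) * 2 ^+ (k * d) :> R.
  by rewrite -exprD -mulnDl subnK.
have -> : sparsity R d * nu_coef f j ^+ 2 = 2 ^+ (4 * d) * 4 ^+ k * 2 ^- (n * d) ^+ 2 *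
    (\sum_(x in dyadic_cube n j) (f x - grid_mean f)) ^+ 2.
  rewrite /nu_coef !exprMn -exprM mulnC exprM (_ : 2 ^+ 2 = 4)//; last by ring.
  rewrite /sparsity !invrK; by field; rewrite !gt_eqF.
have -> : c = 2 ^+ (4 * d) * 4 ^+ k * 2 ^- (n * d) ^+ 2 * 2 ^+ ((n - k) * d).
  by rewrite /c e; field; rewrite !gt_eqF.
rewrite -[leRHS]mulrA; apply: ler_wpM2l; last exact: h.
by rewrite !mulr_ge0 ?exprn_ge0 ?invr_ge0 ?exprn_ge0.
Qed.

(** * Reduction to indicator functions *)

(** A value [t] obtained from either of the two moment bounds.  Taking the
    alternative as the notion lets the choice of the bound depend on the scale. *)
Definition level_bound (R : realType) (n d k : nat) (f : grid n d -> R)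
    (t : R) : Prop :=
  2 ^+ k * grid_mean (fun x => `|f x - grid_mean f|) <= t \/
  (0 < t /\ 2 ^+ (4 * d) * 4 ^+ k * 2 ^- (k * d) *
    grid_mean (fun x => (f x - grid_mean f) ^+ 2) <= t ^+ 2).

Definition level (R : realType) (n d k : nat) (dd : measure_display)
    (T : measurableType dd) (P : probability T R)
    (X : grid k d -> {RV P >-> R}) (f : grid n d -> R) : \bar R :=
  ('E_P[fun w => `|integral_grid f (nu (fun Q => X Q w))|%R])%E.

Lemma level_le (R : realType) (n d k : nat) (dd : measure_display)
  (T : measurableType dd) (P : probability T R)
  (X : grid k d -> {RV P >-> R}) (f : grid n d -> R) (t : R) :
  (k <= n)%N -> iid_sparse_signs (sparsity R d) X -> level_bound k f t ->
  (level X f <= t%:E)%E.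
Proof.
move=> kn iidX.
have -> : level X f = ('E_P[fun w => `|\sum_j nu_coef f j * X j w|%R])%E.
  by rewrite /level; under [in LHS]eq_fun do rewrite integral_nuE.
case=> [ft|[t0 ft]].
  apply: le_trans (expectation_sparse_sum_le_l1 iidX (nu_coef f)) _.
  by rewrite lee_fin (le_trans _ ft)// nu_coef_l1.
apply: (expectation_sparse_sum_le_l2 iidX t0).
by apply: le_trans ft; exact: nu_coef_l2.
Qed.

Lemma measurable_integral_nu (R : realType) (n d k : nat) (dd : measure_display)
  (T : measurableType dd) (P : probability T R)
  (X : grid k d -> {RV P >-> R}) (f : grid n d -> R) :
  measurable_fun setT (fun w => integral_grid f (nu (fun Q => X Q w))).
Proof.
under eq_fun do rewrite integral_nuE.
by apply: measurable_sum => j; exact: measurable_funM.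
Qed.

Lemma integral_gridD (R : realType) (n d : nat) (g h : grid n d -> R) (b : R)
  (m : {set grid n d} -> R) :
  integral_grid (fun x => g x + b * h x) m =
  integral_grid g m + b * integral_grid h m.
Proof.
rewrite /integral_grid mulr_sumr -big_split; apply: eq_bigr => x _.
by rewrite mulrDl mulrA.
Qed.

Lemma level_subadditive (R : realType) (n d k : nat) (dd : measure_display)
  (T : measurableType dd) (P : probability T R)
  (X : grid k d -> {RV P >-> R}) (g h : grid n d -> R) (b : R) : 0 <= b ->
  (level X (fun x => (g x + b * h x)%R) <= level X g + b%:E * level X h)%E.
Proof.
move=> b0; rewrite /level.
have mabs (f : grid n d -> R) :
    measurable_fun setT (fun w => `|integral_grid f (nu (fun Q => X Q w))|).
  by apply: measurableT_comp => //; exact: measurable_integral_nu.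
have mE (f : grid n d -> R) : measurable_fun setT
    (fun w => (`|integral_grid f (nu (fun Q => X Q w))|%R)%:E).
  exact/measurable_EFinP.
pose D w := `|integral_grid g (nu (fun Q => X Q w))| +
  b * `|integral_grid h (nu (fun Q => X Q w))|.
apply: (@le_trans _ _ ('E_P[D])%E).
  apply: expectation_le => //.
  - by apply: measurable_funD => //; apply: measurable_funM.
  - by move=> w; rewrite addr_ge0// mulr_ge0.
  - apply: aeW => w; rewrite integral_gridD (le_trans (ler_normD _ _))//.
    by rewrite normrM (ger0_norm b0).
rewrite unlock; under eq_integral do rewrite /D EFinD EFinM.
rewrite ge0_integralD//; last 2 first.
- by move=> w _; rewrite mule_ge0 ?lee_fin.
- exact: measurable_funeM.
by rewrite ge0_integralZl_EFin.
Qed.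

Lemma integral_nu_cst (R : realType) (n d k : nat) (c : R) (s : grid k d -> R) :
  integral_grid (fun _ : grid n d => c) (nu s) = 0.
Proof.
rewrite integral_nuE big1// => j _; rewrite /nu_coef grid_mean_cst.
by rewrite big1 ?mulr0 ?mul0r// => x _; rewrite subrr.
Qed.

Lemma level_cst (R : realType) (n d k : nat) (dd : measure_display)
  (T : measurableType dd) (P : probability T R)
  (X : grid k d -> {RV P >-> R}) (c : R) :
  level X (fun _ : grid n d => c) = 0%E.
Proof.
rewrite /level; under eq_fun do rewrite integral_nu_cst normr0.
exact: expectation_cst.
Qed.

(** Every real function on a finite set is built from a constant by adding
    positive multiples of indicators of sets on which the function built so
    far is maximal.  To undo one step, lower the top value of [f] to the next
    one; this decreases the number of points below the maximum. *)
Lemma layer_cake_ind (R : realType) (T : finType) (Q : (T -> R) -> Prop) :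
  (forall c, Q (fun=> c)) ->
  (forall (g : T -> R) (A : {set T}) (c b : R), 0 <= b ->
    (forall x, g x <= c) -> (forall x, x \in A -> g x = c) ->
    Q g -> Q (fun x => g x + b * indic_set R A x)) ->
  forall f, Q f.
Proof.
move=> Qc QD f.
have fM x : f x <= \sum_y `|f y|.
  by rewrite (bigD1 x)//= (le_trans (ler_norm _))// lerDl sumr_ge0.
move: (\sum_y _) fM => M.
have [N] := ubnP #|[set x | f x < M]%SET|; elim: N f M => // N IH f M fN fM.
have [S0|/finset.set0Pn[x0 x0S]] := eqVneq [set x | f x < M]%SET finset.set0.
  have -> : f = fun=> M; last exact: Qc.
  apply/funext => x; apply/eqP; rewrite eq_le fM leNgt; apply/negP => xM.
  by have := finset.in_set0 x; rewrite -S0 inE xM.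
set S := [set x | f x < M]%SET in fN x0S.
have [x1 x1S x1max] : exists2 x1, x1 \in S & forall x, x \in S -> f x <= f x1.
  by have := @arg_maxP _ _ _ x0 (mem S) f x0S; case => x ? ?; exists x.
pose g x := Num.min (f x) (f x1).
have x1M : f x1 < M by move: x1S; rewrite inE.
have gA x : x \in (~: S)%SET -> g x = f x1.
  by rewrite !inE -leNgt => Mx; apply/min_idPr; rewrite (le_trans (ltW x1M)).
have -> : f = fun x => g x + (M - f x1) * indic_set R (~: S)%SET x.
  apply/funext => x; rewrite /indic_set; have [xS|xS] := boolP (x \in (~: S)%SET).
    by rewrite gA// mulr1 addrC subrK; apply/eqP; rewrite eq_le fM; move: xS; rewrite !inE -leNgt.
  rewrite mulr0 addr0 /g; apply/esym/min_idPl/x1max.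
  by move: xS; rewrite finset.in_setC negbK.
apply: (QD g _ (f x1)) => //.
- by rewrite subr_ge0 ltW.
- by move=> x; rewrite ge_min lexx orbT.
apply: (IH g (f x1)); last by move=> x; rewrite ge_min lexx orbT.
rewrite -ltnS (leq_trans _ fN)// ltnS; apply: proper_card; apply/properP; split.
  apply/fintype.subsetP => x; rewrite !inE /g gt_min ltxx orbF => /lt_trans; exact.
by exists x1 => //; rewrite inE /g minxx ltxx.
Qed.

(** The difference of [g] across an edge and that of the indicator of [A] never
    have opposite signs, because [g] is maximal on [A]. *)
Lemma total_variation_layer (R : realType) (I : finType) (N : nat)
  (g : {ffun I -> 'I_N} -> R) (A : {set {ffun I -> 'I_N}}) (c b : R) :
  0 <= b -> (forall x, g x <= c) -> (forall x, x \in A -> g x = c) ->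
  total_variation (fun x => g x + b * indic_set R A x) =
  total_variation g + b * total_variation (indic_set R A).
Proof.
move=> b0 gc gA; rewrite /total_variation mulr_sumr -big_split; apply: eq_bigr => i _.
rewrite /variation mulr_sumr -big_split; apply: eq_bigr => x _ /=.
move: (set_coord _ _ _) => y; rewrite /indic_set.
have [xA|xA] := boolP (x \in A); have [yA|yA] := boolP (y \in A) => /=.
- by rewrite !gA// !subrr normr0 mulr0 addr0.
- rewrite (gA x)// !ler0_norm ?subr_le0//; first by ring.
  by rewrite mulr0 mulr1 addr0 (le_trans (gc y))// lerDl.
- rewrite (gA y)// !ger0_norm ?subr_ge0//; first by ring.
  by rewrite mulr0 mulr1 addr0 (le_trans (gc x))// lerDl.
- by rewrite !mulr0 !addr0 subrr normr0 mulr0 addr0.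
Qed.

(** * Summing over the scales *)

(** The isoperimetric inequality in terms of the density of [A].  A set with at
    most [L^d] points has at least the relative boundary of a cube of side [L];
    the term [2^n - L] accounts for the lines that are filled by [A]. *)
Lemma sobolev11_isoperimetry (R : realType) (n d : nat) (A : {set grid n d})
  (L : R) : (0 < n)%N -> (0 < d)%N -> 0 < L -> #|A|%:R <= L ^+ d ->
  2 ^- (n * d) * #|A|%:R * (2 ^+ n - L) <= L * sobolev11 (indic_set R A).
Proof.
move=> n0 d0 L0 AL.
have V0 : 0 < 2 ^+ (n * d) :> R by rewrite exprn_gt0.
have dR : 0 < d%:R :> R by rewrite ltr0n.
have := @total_variation_isoperimetry R _ (2 ^ n) A L L0.
rewrite card_ord natrX => /(_ AL) iso.
have := ler_wpM2l (ltW L0) (total_variation_le_sobolev11 (indic_set R A) n0 d0).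
move/(le_trans iso) => h; rewrite -(ler_pM2l V0) -(ler_pM2l dR).
have -> : d%:R * (2 ^+ (n * d) * (2 ^- (n * d) * #|A|%:R * (2 ^+ n - L))) =
    d%:R * #|A|%:R * (2 ^+ n - L) by field; rewrite gt_eqF.
by apply: le_trans h _; rewrite le_eqVlt; apply/orP; left; apply/eqP; ring.
Qed.

Lemma sobolev11_ge0 (R : realType) (n d : nat) (f : grid n d -> R) :
  0 <= sobolev11 f.
Proof.
by rewrite sobolev11E !mulr_ge0 ?invr_ge0 ?exprn_ge0 ?total_variation_ge0.
Qed.

Lemma indic_deviation_l1 (R : realType) (n d : nat) (A : {set grid n d}) :
  grid_mean (fun x => `|indic_set R A x - grid_mean (indic_set R A)|) <=
    2 * grid_mean (indic_set R A).
Proof.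
set a := grid_mean (indic_set R A); have a0 : 0 <= a by apply: grid_mean_ge0 => x; rewrite /indic_set.
rewrite mulr2n mulrDl mul1r -{3}(grid_mean_cst n d a) -grid_meanD.
apply: grid_mean_le => x; apply: le_trans (ler_normB _ _) _.
by rewrite !ger0_norm// /indic_set.
Qed.

Lemma indic_deviation_l2 (R : realType) (n d : nat) (A : {set grid n d}) :
  grid_mean (fun x => (indic_set R A x - grid_mean (indic_set R A)) ^+ 2) <=
    grid_mean (indic_set R A).
Proof.
set a := grid_mean (indic_set R A).
have E : grid_mean (fun x => (indic_set R A x - a) ^+ 2) = a - a ^+ 2.
  have -> : (fun x => (indic_set R A x - a) ^+ 2) =
      (fun x => (1 - 2 * a) * indic_set R A x + a ^+ 2).
    by apply/funext => x; rewrite /indic_set; case: (x \in A) => /=; ring.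
  rewrite grid_meanD grid_mean_cst {1}/grid_mean -mulr_sumr mulrCA.
  by rewrite -/(grid_mean _) -/a; ring.
by rewrite E lerBlDr lerDl sqr_ge0.
Qed.

Lemma level_bound_indicC (R : realType) (n d k : nat) (A : {set grid n d}) (t : R) :
  level_bound k (indic_set R (~: A)%SET) t -> level_bound k (indic_set R A) t.
Proof.
have CE x : indic_set R (~: A)%SET x = 1 - indic_set R A x.
  by rewrite /indic_set inE; case: (x \in A) => /=; ring.
have mE : grid_mean (indic_set R (~: A)%SET) = 1 - grid_mean (indic_set R A).
  have := grid_meanD (indic_set R (~: A)%SET) (indic_set R A).
  under eq_fun do rewrite CE subrK.
  by rewrite grid_mean_cst => ->; rewrite addrK.
have dE x : indic_set R (~: A)%SET x - grid_mean (indic_set R (~: A)%SET) =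
    - (indic_set R A x - grid_mean (indic_set R A)).
  by rewrite CE mE; ring.
rewrite /level_bound; under eq_fun do rewrite dE normrN.
by under [X in _ \/ (_ /\ _ * grid_mean X <= _)]eq_fun do rewrite dE sqrrN.
Qed.

Lemma sobolev11_indicC (R : realType) (n d : nat) (A : {set grid n d}) :
  sobolev11 (indic_set R (~: A)%SET) = sobolev11 (indic_set R A).
Proof.
rewrite !sobolev11E; congr (_ * (_ * _)).
apply: eq_bigr => i _; apply: eq_bigr => x _; rewrite /indic_set !inE.
by do 2 case: (_ \in A) => /=; rewrite ?subrr // distrC.
Qed.

Lemma sum_pow2_le (R : realType) (M : nat) :
  \sum_(0 <= k < M) 2 ^+ k <= 2 ^+ M :> R.
Proof.
elim: M => [|M IH]; first by rewrite big_geq// ler01.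
by rewrite big_nat_recr//= exprS mulr2n mulrDl mul1r lerD2r.
Qed.

Lemma sum_geometric_le (R : realType) (M : nat) :
  \sum_(0 <= k < M) (3 / 4) ^+ k <= 4 :> R.
Proof.
suff -> : \sum_(0 <= k < M) (3 / 4) ^+ k = 4 * (1 - (3 / 4) ^+ M) :> R.
  by rewrite ler_piMr// gerBl exprn_ge0// divr_ge0.
elim: M => [|M IH]; first by rewrite big_geq// expr0 subrr mulr0.
by rewrite big_nat_recr//= IH exprS; field.
Qed.

Lemma sum_nat_tail_le (R : realType) (F : nat -> R) (M K : nat) :
  (forall k, 0 <= F k) ->
  \sum_(M <= k < K) F k <= \sum_(0 <= i < K) F (M + i)%N.
Proof.
move=> F0; rewrite -{1}[M]add0n big_addn.
rewrite [leRHS](big_cat_nat (leq0n (K - M)) (leq_subr M K))/=.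
under eq_bigr do rewrite addnC.
by rewrite lerDl sumr_ge0.
Qed.

Lemma sum_nat_drop_le (R : realType) (F : nat -> R) (M K : nat) :
  (forall k, 0 <= F k) -> \sum_(M <= k < K) F k <= \sum_(0 <= k < K) F k.
Proof.
move=> F0; case: (leqP M K) => [MK|/ltnW KM]; last by rewrite big_geq// sumr_ge0.
by rewrite [leRHS](big_cat_nat (leq0n M) MK)/= lerDr sumr_ge0.
Qed.

Lemma sum_nat_split_le (R : realType) (F : nat -> R) (M K : nat) :
  (forall k, 0 <= F k) ->
  \sum_(0 <= k < K) F k <=
    \sum_(0 <= k < M) F k + \sum_(0 <= i < K) F (M + i)%N.
Proof.
move=> F0; case: (leqP M K) => [MK|/ltnW KM].
  by rewrite (big_cat_nat (n := M))//= lerD2l sum_nat_tail_le.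
rewrite [in leRHS](big_cat_nat (n := K))//= -addrA lerDl addr_ge0// sumr_ge0//.
Qed.

(** The factor [4^i] comes from the weights [2^k] (squared), [2^(-i d)] from the
    number of cubes; the assumption [3 <= d] leaves a geometric decay with
    ratio at most [(3/4)^2], since [4 <= (9/16) * 8]. *)
Lemma decay_factor (R : realType) (d i : nat) : (3 <= d)%N ->
  4 ^+ i <= (3 / 4) ^+ i ^+ 2 * 2 ^+ (i * d) :> R.
Proof.
move=> d3; apply: (@le_trans _ _ ((3 / 4) ^+ i ^+ 2 * 2 ^+ (i * 3))).
  rewrite -exprM [(i * 2)%N]mulnC exprM [(i * 3)%N]mulnC exprM -exprMn.
  by rewrite lerXn2r ?nnegrE//; lra.
by rewrite ler_wpM2l ?exprn_ge0 ?divr_ge0// ler_eXn2l ?ltr1n// leq_mul2l d3 orbT.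
Qed.

Lemma half_le_pow (R : realType) (d : nat) : (0 < d)%N ->
  1 / 2 <= (1 - (2 * d%:R)^-1) ^+ d :> R.
Proof.
case: d => // r _; set m : R := 1 - _.
have r0 : 0 < r.+1%:R :> R by rewrite ltr0n.
have m0 : 0 <= m.
  rewrite subr_ge0 invf_le1 ?mulr_gt0//.
  by rewrite -natrM ler1n muln_gt0.
have := weighted_AMGM r (@ler01 R) m0; rewrite !expr1n mul1r mulr1.
have -> : r.+1%:R * m = r.+1%:R - 1 / 2 by rewrite /m; move: r0; move: r.+1%:R => D D0; field; rewrite gt_eqF.
by rewrite -natr1; lra.
Qed.

(** Compare [A] with a cube of side [2^(n-m)]. *)
Lemma sobolev11_indic_ge_scale (R : realType) (n d m : nat)
  (A : {set grid n d}) : (0 < n)%N -> (0 < d)%N -> (0 < m)%N ->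
  (#|A| * 2 ^ (m * d) <= 2 ^ (n * d))%N ->
  grid_mean (indic_set R A) * 2 ^+ m <= 2 * sobolev11 (indic_set R A).
Proof.
move=> n0 d0 m0 mA; set s := sobolev11 _; set a := grid_mean _.
have pow0 i : 0 < 2 ^+ i :> R by rewrite exprn_gt0.
pose L : R := 2 ^+ n * 2 ^- m.
have L0 : 0 < L by rewrite mulr_gt0 ?invr_gt0.
have AL : #|A|%:R <= L ^+ d.
  rewrite exprMn exprVn -!exprM ler_pdivlMr//.
  by rewrite -!natrX -natrM ler_nat.
have := sobolev11_isoperimetry n0 d0 L0 AL; rewrite -grid_mean_indic -/a -/s.
have -> : a * (2 ^+ n - L) = L * (a * (2 ^+ m - 1)).
  by rewrite /L; field; rewrite gt_eqF.
rewrite ler_pM2l// => as1.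
have m2 : 2 <= 2 ^+ m :> R by rewrite -{1}[2]expr1 ler_eXn2l// ltr1n.
have a0 : 0 <= a by apply: grid_mean_ge0 => x; rewrite /indic_set.
have := ler_wpM2l a0 m2; lra.
Qed.

(** Compare [A] with a cube of side [2^n (1 - 1/(2d))], which fills at least half
    of the grid by [half_le_pow].  The loss of the factor [d] is unavoidable: for
    a half-space the norm is of order [1/d]. *)
Lemma sobolev11_indic_ge_mean (R : realType) (n d : nat) (A : {set grid n d}) :
  (0 < n)%N -> (0 < d)%N -> (2 * #|A| <= 2 ^ (n * d))%N ->
  grid_mean (indic_set R A) <= 2 * d%:R * sobolev11 (indic_set R A).
Proof.
move=> n0 d0 half; set s := sobolev11 _; set a := grid_mean _.
have pow0 i : 0 < 2 ^+ i :> R by rewrite exprn_gt0.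
have dR : 0 < d%:R :> R by rewrite ltr0n.
pose L : R := 2 ^+ n * (1 - (2 * d%:R)^-1).
have inv_d : (2 * d%:R)^-1 <= 1 / 2 :> R.
  by rewrite div1r lef_pV2 ?posrE ?mulr_gt0// ler_peMr// ler1n.
have inv_d0 : 0 < (2 * d%:R)^-1 :> R by rewrite invr_gt0 mulr_gt0.
have L0 : 0 < L by rewrite mulr_gt0// subr_gt0 (le_lt_trans inv_d)//; lra.
have AL : #|A|%:R <= L ^+ d.
  have := ler_wpM2l (ltW (pow0 (n * d)%N)) (half_le_pow R d0).
  rewrite exprM -exprMn -/L; apply: le_trans.
  by rewrite mulrA mulr1 ler_pdivlMr// -exprM -natrX -natrM ler_nat mulnC.
have LN : L <= 2 ^+ n by rewrite ler_piMr// ?ltW//; lra.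
have : a * (2 ^+ n - L) <= 2 ^+ n * s.
  rewrite /a grid_mean_indic.
  apply: le_trans (sobolev11_isoperimetry n0 d0 L0 AL) _.
  by rewrite ler_wpM2r// sobolev11_ge0.
have -> : a * (2 ^+ n - L) = 2 ^+ n * (a / (2 * d%:R)).
  by rewrite /L; field; rewrite gt_eqF.
by rewrite ler_pM2l// ler_pdivrMr ?mulr_gt0// mulrC.
Qed.

Lemma level_bound_indic_l1 (R : realType) (n d k : nat) (A : {set grid n d}) :
  level_bound k (indic_set R A) (2 ^+ k * (2 * grid_mean (indic_set R A))).
Proof. by left; rewrite ler_wpM2l ?exprn_ge0// indic_deviation_l1. Qed.

Lemma level_bound_indic_l2 (R : realType) (n d k : nat) (A : {set grid n d})
  (t : R) : 0 < t ->
  2 ^+ (4 * d) * 4 ^+ k * 2 ^- (k * d) * grid_mean (indic_set R A) <= t ^+ 2 ->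
  level_bound k (indic_set R A) t.
Proof.
move=> t0 h; right; split => //; apply: le_trans h.
by rewrite ler_wpM2l ?indic_deviation_l2.
Qed.

(** The constant [2^16] serves all densities: it exceeds both [2^11], which is
    what [multiscale_bounded_large] yields, and [2^15 + 16], which is what
    [multiscale_bounded_small] yields. *)
Definition multiscale_bounded (R : realType) (n d : nat) (f : grid n d -> R) :
    Prop :=
  exists t : nat -> R, (forall k, (8 <= k)%N -> level_bound k f (t k)) /\
    \sum_(8 <= k < n.+1) t k <= 2 ^+ 16 * sobolev11 f.

(** For sets of density at least [2^(-d)] the second moment bound is good enough
    at all generations: at [k = 8] the number of cubes [2^(8d)] outweighs both
    the sparsity [2^(4d)] and the density, with room for the factor [1/d^2]. *)
Lemma multiscale_bounded_large (R : realType) (n d : nat) (A : {set grid n d}) :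
  (0 < n)%N -> (3 <= d)%N -> (2 * #|A| <= 2 ^ (n * d))%N ->
  1 <= grid_mean (indic_set R A) * 2 ^+ d ->
  multiscale_bounded (indic_set R A).
Proof.
move=> n0 d3 half; have d0 : (0 < d)%N by apply: leq_trans d3.
have := sobolev11_indic_ge_mean R n0 d0 half.
have := @level_bound_indic_l2 R n d ^~ A; rewrite /multiscale_bounded.
set s := sobolev11 _; move: (grid_mean _) => a sparse as2 aD.
have pow0 i : 0 < 2 ^+ i :> R by rewrite exprn_gt0.
have a0 : 0 < a by move: (lt_le_trans ltr01 aD); rewrite pmulr_lgt0.
have dR : 0 < d%:R :> R by rewrite ltr0n.
pose t k : R := 2 ^+ 8 * (3 / 4) ^+ (k - 8) * (a / d%:R).
have q0 i : 0 < (3 / 4) ^+ i :> R by rewrite exprn_gt0.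
have t0 k : 0 < t k by rewrite /t mulr_gt0 ?divr_gt0// mulr_gt0.
exists t; split => [k k8|].
  apply: sparse => //; rewrite /t -{1 2}(subnKC k8); set i := (k - 8)%N.
  have dD : d%:R <= 2 ^+ d :> R by rewrite -natrX ler_nat ltnW// ltn_expl.
  have D1 : 1 <= 2 ^+ d :> R by rewrite exprn_ege1// ler1n.
  have := decay_factor R i d3; rewrite mulnDl exprD (exprD 2).
  rewrite [(4 * d)%N]mulnC [(8 * d)%N]mulnC !(exprM 2 d).
  have := pow0 (i * d)%N; have := pow0 d.
  move: (q0 i) (exprn_ge0 i (ler0n R 4)) aD dD D1.
  move: (2 ^+ d) (2 ^+ (i * d)) (4 ^+ i) ((3 / 4) ^+ i).
  move=> D W x q q1 x0 aD dD D1 D0 W0 xq.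
  have -> : D ^+ 4 * (4 ^+ 8 * x) * (D ^+ 8 * W)^-1 * a =
     2 ^+ 16 * a * (D ^- 4 * (x * W^-1)) by field; rewrite !gt_eqF.
  have -> : (2 ^+ 8 * q * (a / d%:R)) ^+ 2 =
     2 ^+ 16 * a * (a / d%:R ^+ 2 * q ^+ 2) by field; rewrite gt_eqF.
  apply: ler_wpM2l; first by rewrite mulr_ge0 ?exprn_ge0 ?(ltW a0).
  apply: ler_pM.
  - by rewrite invr_ge0 exprn_ge0 ?ltW.
  - by rewrite divr_ge0 ?(ltW W0).
  - rewrite ler_pdivlMr ?exprn_gt0// mulrC ler_pdivrMr ?exprn_gt0//.
    (* d <= 2^d and 1 <= a 2^d give d^2 <= a (2^d)^4. *)
    have d2 : d%:R ^+ 2 <= D ^+ 2 by rewrite lerXn2r ?nnegrE ?(ltW D0).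
    have -> : a * D ^+ 4 = a * D * D * D ^+ 2 by ring.
    apply: (le_trans d2); rewrite -[leLHS]mul1r.
    by rewrite ler_wpM2r ?exprn_ge0 ?(ltW D0)// mulr_ege1.
  - by rewrite ler_pdivrMr.
apply: (le_trans (sum_nat_tail_le _ _ (fun k => ltW (t0 k)))).
rewrite /t; under eq_bigr do rewrite addKn.
rewrite -mulr_suml -mulr_sumr.
have a_d : a / d%:R <= 2 * s by rewrite ler_pdivrMr// -mulrA (mulrC s) mulrA.
have s0 : 0 <= s by exact: sobolev11_ge0.
have := sum_geometric_le R n.+1.
have : 0 <= \sum_(0 <= i < n.+1) (3 / 4) ^+ i :> R.
  by apply: sumr_ge0 => i _; exact: ltW.
move: (\sum_(0 <= _ < _) _) => G G0 G4.
apply: (@le_trans _ _ (2 ^+ 8 * 4 * (2 * s))); last by lra.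
apply: ler_pM => //; first by rewrite mulr_ge0.
  by rewrite divr_ge0 ?(ltW a0).
by rewrite ler_wpM2l.
Qed.

(** Cubes larger than the scale [2^(-m)] of [A], up to 12 further generations,
    are treated by the first moment bound, whose sum is dominated by its last
    term; smaller cubes by the second moment bound, which decays from there. *)
Lemma multiscale_bounded_small (R : realType) (n d m : nat)
  (A : {set grid n d}) : (0 < n)%N -> (3 <= d)%N -> (0 < m)%N ->
  (#|A| * 2 ^ (m * d) <= 2 ^ (n * d))%N ->
  1 <= grid_mean (indic_set R A) * 2 ^+ (m.+1 * d) ->
  multiscale_bounded (indic_set R A).
Proof.
move=> n0 d3 m0 mA; have d0 : (0 < d)%N by apply: leq_trans d3.
have := sobolev11_indic_ge_scale R n0 d0 m0 mA.
have := @level_bound_indic_l2 R n d ^~ A.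
have := @level_bound_indic_l1 R n d ^~ A; rewrite /multiscale_bounded.
set s := sobolev11 _; move: (grid_mean _) => a dense sparse as2 aZ.
have pow0 i : 0 < 2 ^+ i :> R by rewrite exprn_gt0.
have a0 : 0 < a by move: (lt_le_trans ltr01 aZ); rewrite pmulr_lgt0.
pose t k : R := if (k < m + 13)%N then 2 ^+ k * (2 * a)
  else 2 * (a * 2 ^+ m) * (3 / 4) ^+ (k - (m + 13)).
have q0 i : 0 < (3 / 4) ^+ i :> R by rewrite exprn_gt0.
have am0 : 0 < a * 2 ^+ m by rewrite pmulr_rgt0.
have t0 k : 0 < t k.
  rewrite /t; case: ifP => _; first by rewrite pmulr_rgt0// pmulr_rgt0.
  by rewrite pmulr_lgt0// pmulr_rgt0.
exists t; split => [k _|].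
  move: (t0 k); rewrite /t; case: ltnP => km tk0; first exact: dense.
  apply: sparse => //; rewrite -{1 2}(subnKC km); set i := (k - (m + 13))%N.
  have D8 : 8 <= 2 ^+ d :> R.
    by rewrite (_ : 8 = 2 ^+ 3) ?ler_eXn2l ?ltr1n//; ring.
  have -> : ((m + 13 + i) * d = m.+1 * d + (d * 12 + i * d))%N.
    by rewrite !mulnDl; lia.
  rewrite (exprD 4) (exprD 4 m) exprD (exprD 2 (d * 12)) [(4 * d)%N]mulnC.
  rewrite !(exprM 2 d).
  have -> : 4 ^+ m = 2 ^+ m ^+ 2 :> R.
    by rewrite -exprM mulnC exprM; congr (_ ^+ _); ring.
  have := decay_factor R i d3; have := pow0 (i * d)%N; have := pow0 m.
  have := pow0 (m.+1 * d)%N.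
  move: (q0 i) (exprn_ge0 i (ler0n R 4)) D8 aZ.
  move: (2 ^+ d) (2 ^+ (i * d)) (4 ^+ i) ((3 / 4) ^+ i) (2 ^+ m).
  move: (2 ^+ (m.+1 * d)) => Y D W x q Z q1 x0 D8 aY Y0 Z0 W0 xq.
  have D0 : 0 < D by lra.
  have -> : D ^+ 4 * (Z ^+ 2 * 4 ^+ 13 * x) * (Y * (D ^+ 12 * W))^-1 * a =
      4 * a * Z ^+ 2 * (4 ^+ 12 * D ^- 8 * (x * W^-1 * Y^-1)).
    by field; rewrite !gt_eqF.
  have -> : (2 * (a * Z) * q) ^+ 2 = 4 * a * Z ^+ 2 * (1 * (q ^+ 2 * a)).
    by ring.
  have W'0 : 0 <= x * W^-1 by rewrite divr_ge0 ?(ltW W0).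
  apply: ler_wpM2l.
    by rewrite mulr_ge0 ?exprn_ge0 ?(ltW Z0)// mulr_ge0 ?(ltW a0).
  apply: ler_pM.
  - by rewrite divr_ge0 ?exprn_ge0 ?(ltW D0).
  - by rewrite divr_ge0 ?(ltW Y0).
  (* Twelve scales past m + 1, the factor 4^12 = 8^8 is absorbed since 8 <= 2^d. *)
  - rewrite ler_pdivrMr ?exprn_gt0// mul1r (_ : 4 ^+ 12 = 8 ^+ 8); last by ring.
    by rewrite lerXn2r ?nnegrE ?(ltW D0).
  - apply: ler_pM => //; first by rewrite invr_ge0 ltW.
      by rewrite ler_pdivrMr.
    by rewrite -[leLHS]mul1r ler_pdivrMr.
have F0 k : 0 <= t k by exact: ltW.
apply: (le_trans (sum_nat_drop_le _ _ F0)).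
apply: (le_trans (sum_nat_split_le (m + 13) _ F0)).
apply: (@le_trans _ _ (2 ^+ (m + 13) * (2 * a) + 2 * (a * 2 ^+ m) * 4)).
  apply: lerD.
    rewrite (eq_big_nat _ _ (F2 := fun k => 2 ^+ k * (2 * a))).
      by rewrite -mulr_suml ler_wpM2r ?sum_pow2_le// mulr_ge0 ?(ltW a0).
    by move=> k /andP[_ km]; rewrite /t km.
  rewrite (eq_bigr (fun i => 2 * (a * 2 ^+ m) * (3 / 4) ^+ i)).
    by rewrite -mulr_sumr ler_wpM2l ?sum_geometric_le// mulr_ge0 ?(ltW am0).
  by move=> i _; rewrite /t ltnNge leq_addr addKn.
have s0 : 0 <= s by exact: sobolev11_ge0.
by rewrite exprD; lra.
Qed.

(** Dispatch on the largest [m] such that [A] has density at most [2^(-m d)]. *)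
Lemma multiscale_bounded_half (R : realType) (n d : nat) (A : {set grid n d}) :
  (0 < n)%N -> (3 <= d)%N -> (2 * #|A| <= 2 ^ (n * d))%N ->
  multiscale_bounded (indic_set R A).
Proof.
move=> n0 d3 half; have d0 : (0 < d)%N by apply: leq_trans d3.
have [A0|A0] := posnP #|A|.
  have a0 : grid_mean (indic_set R A) = 0 by rewrite grid_mean_indic A0 mulr0.
  exists (fun=> 0); split => [k _|].
    by have := level_bound_indic_l1 R k A; rewrite a0 !mulr0.
  by rewrite big1// mulr_ge0 ?exprn_ge0// sobolev11_ge0.
have ex0 : exists m, (#|A| * 2 ^ (m * d) <= 2 ^ (n * d))%N.
  exists 0%N; rewrite mul0n muln1 (leq_trans _ half)//.
  by rewrite mul2n -addnn leq_addr.
have bnd m : (#|A| * 2 ^ (m * d) <= 2 ^ (n * d))%N -> (m <= n)%N.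
  move=> h; have : (2 ^ (m * d) <= 2 ^ (n * d))%N.
    by apply: leq_trans h; rewrite leq_pmull.
  by rewrite leq_exp2l// leq_pmul2r.
case: (ex_maxnP ex0 bnd) => m mA mmax.
have a_inv : 1 <= grid_mean (indic_set R A) * 2 ^+ (m.+1 * d).
  rewrite grid_mean_indic -mulrA ler_pdivlMl ?exprn_gt0// mulr1.
  rewrite -!natrX -natrM ler_nat ltnW// ltnNge.
  by apply/negP => /mmax; rewrite ltnn.
have [m0|m0] := posnP m; last exact: (multiscale_bounded_small n0 d3 m0 mA).
by apply: multiscale_bounded_large => //; move: a_inv; rewrite m0 mul1n.
Qed.

Lemma multiscale_bounded_indic (R : realType) (n d : nat) (A : {set grid n d}) :
  (0 < n)%N -> (3 <= d)%N -> multiscale_bounded (indic_set R A).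
Proof.
move=> n0 d3; case: (leqP (2 * #|A|) (2 ^ (n * d))) => [half|half].
  exact: multiscale_bounded_half.
have cA : (#|A| + #|(~: A)%SET| = 2 ^ (n * d))%N.
  by rewrite cardsC card_ffun !card_ord expnM.
have halfC : (2 * #|(~: A)%SET| <= 2 ^ (n * d))%N.
  by move: half; rewrite -cA !mul2n -!addnn leq_add2r ltn_add2l => /ltnW.
have [t [tb ts]] := multiscale_bounded_half R n0 d3 halfC.
exists t; split => [k k8|]; first exact/level_bound_indicC/tb.
by rewrite -sobolev11_indicC.
Qed.

Theorem theorem4p1 (R : realType) :
  exists C : R,
    forall (n d : nat), (1 <= n)%N -> (3 <= d)%N ->
    forall (dd : measure_display) (T : measurableType dd)
      (P : probability T R)
      (X : forall k : nat, grid k d -> {RV P >-> R}),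
    (forall k : nat, (1 <= k <= n)%N ->
       iid_sparse_signs (sparsity R d) (X k)) ->
    forall f : grid n d -> R,
      (\sum_(8 <= k < n.+1)
         'E_P[fun w => `|integral_grid f (nu (fun Q => X k Q w))|%R]
       <= (C * sobolev11 f)%:E)%E.
Proof.
exists (2 ^+ 16) => n d n0 d3 dd T P X iidX.
change (forall f : grid n d -> R, (\sum_(8 <= k < n.+1) level (X k) f
  <= (2 ^+ 16 * sobolev11 f)%:E)%E).
have iid k : (8 <= k < n.+1)%N -> (k <= n)%N /\ iid_sparse_signs (sparsity R d) (X k).
  move=> /andP[k8 kn]; split => //; apply: iidX.
  by apply/andP; split; [apply: leq_trans k8|].
have indic_case (A : {set grid n d}) :
    (\sum_(8 <= k < n.+1) level (X k) (indic_set R A)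
      <= (2 ^+ 16 * sobolev11 (indic_set R A))%:E)%E.
  have [t [tb ts]] := multiscale_bounded_indic R A n0 d3.
  apply: (@le_trans _ _ (\sum_(8 <= k < n.+1) t k)%:E); last by rewrite lee_fin.
  rewrite -sumEFin big_nat [leRHS]big_nat; apply: lee_sum => k kn.
  have [kn' iidk] := iid k kn; apply: level_le => //; apply: tb.
  by case/andP: kn.
apply: layer_cake_ind => [c|g A c b b0 gc gA IH].
  rewrite big1 => [|k _]; last exact: level_cst.
  by rewrite lee_fin mulr_ge0 ?exprn_ge0 ?sobolev11_ge0.
apply: (@le_trans _ _ (\sum_(8 <= k < n.+1) level (X k) g +
    b%:E * \sum_(8 <= k < n.+1) level (X k) (indic_set R A))%E).
  rewrite ge0_sume_distrr; last by move=> k _; apply: expectation_ge0.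
  by rewrite -big_split; apply: lee_sum => k _; exact: level_subadditive.
apply: (@le_trans _ _ ((2 ^+ 16 * sobolev11 g)%:E +
    b%:E * (2 ^+ 16 * sobolev11 (indic_set R A))%:E)%E).
  by apply: leeD => //; apply: lee_wpmul2l; rewrite ?lee_fin.
rewrite -EFinM -EFinD lee_fin !sobolev11E (total_variation_layer b0 gc gA).
by rewrite le_eqVlt; apply/orP; left; apply/eqP; ring.
Qed.
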